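(* Let $G$ be a finitely generated group. (a) $\operatorname{CL}_G$ is bounded if and only if $|G/Z(G)|<\infty$, where $Z(G)$ is the center of $G$. (b) If $\operatorname{CL}_G$ is unbounded, then it is at least linear.
   Context: $\mathbb N$ denotes the set of positive integers. For a group $G$ generated by a finite set $X$, $|g|_X$ is the word length of $g\in G$ with respect to $X$. For conjugate $a,b\in G$ let $c_X(a,b)=\min\{|g|_X \mid g\in G,\ g^{-1}ag=b\}$. The conjugator length function of $G$ with respect to $X$ is $\operatorname{CL}_{G,X}(n)=\max\{c_X(a,b)\}$, where the maximum is over all pairs of conjugate elements $a,b\in G$ with $|a|_X+|b|_X\le n$. For $f,g\colon\mathbb N\to\mathbb N\cup\{0\}$ write $f\preccurlyeq g$ if there exist $C,D\in\mathbb N$ such that $f(n)\le C g(Dn)$ for all $n\in\mathbb N$; write $f\sim g$ if $f\preccurlyeq g$ and $g\preccurlyeq f$. A function $f\colon\mathbb N\to\mathbb N\cup\{0\}$ is at least linear if $n\preccurlyeq f(n)$. Up to $\sim$, $\operatorname{CL}_{G,X}$ does not depend on the choice of finite generating set $X$, and $\operatorname{CL}_G$ denotes $\operatorname{CL}_{G,X}$ for any finite generating set $X$, considered up to $\sim$. *)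

(* Defs.v *)
From mathcomp Require Import all_boot all_order.
From mathcomp Require Import mathcomp_extra boolp classical_sets functions.
From mathcomp Require Import cardinality.

Set Implicit Arguments.
Unset Strict Implicit.
Unset Printing Implicit Defensive.

Local Open Scope classical_set_scope.
Local Open Scope group_scope.

(* Minimum and maximum of a set of natural numbers; the value 0 is used when
   there is none. [word_length_min], [conj_length_min] and [CL_max] below show
   that this does not happen in the definitions of this file. *)
Definition natmin (A : set nat) : nat :=
  xget 0%N [set m | A m /\ forall k, A k -> (m <= k)%N].

Definition natmax (A : set nat) : nat :=
  xget 0%N [set m | A m /\ forall k, A k -> (k <= m)%N].

Section Groups.
Variable G : groupType.
Implicit Types (X H : set G) (a b g : G) (w : seq G).

Definition is_subgroup H : Prop := H 1 /\ forall x y, H x -> H y -> H (x / y).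

Definition generates X : Prop := smallest is_subgroup X = setT.

Definition is_word X w : Prop := forall x, x \in w -> X x \/ X x^-1.

Definition word_length X g : nat :=
  natmin [set size w | w in [set w | is_word X w /\ \prod_(x <- w) x = g]].

Definition conjugate a b : Prop := exists g, a ^ g = b.

Definition conj_length X a b : nat :=
  natmin [set word_length X g | g in [set g | a ^ g = b]].

Definition CL X (n : nat) : nat :=
  natmax [set conj_length X p.1 p.2 | p in
    [set p : G * G | conjugate p.1 p.2 /\
                     (word_length X p.1 + word_length X p.2 <= n)%N]].

Definition center : set G := [set z | forall g, commute z g].

(* The underlying set of G / Z(G). *)
Definition center_cosets : set (set G) :=
  range (fun g => [set g * z | z in center]).

End Groups.

Arguments center G : clear implicits.
Arguments center_cosets G : clear implicits.

(* Functions on the positive integers are represented by functions on [nat],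
   whose value at 0 is never used. *)
Definition preceq (f g : nat -> nat) : Prop :=
  exists C D : nat, [/\ (0 < C)%N, (0 < D)%N &
    forall n, (0 < n)%N -> (f n <= C * g (D * n))%N].

Definition at_least_linear (f : nat -> nat) : Prop := preceq (fun n => n) f.

Definition bounded (f : nat -> nat) : Prop :=
  exists M : nat, forall n, (0 < n)%N -> (f n <= M)%N.

Lemma natminP (A : set nat) :
  A !=set0 -> A (natmin A) /\ forall k, A k -> (natmin A <= k)%N.
Proof.
move=> [k Ak].
apply: (@xgetPex _ 0%N [set m | A m /\ forall k, A k -> (m <= k)%N]).
have exA : exists m, `[< A m >] by exists k; apply/asboolP.
case: (ex_minnP exA) => m /asboolP Am mmin.
by exists m; split=> // j Aj; apply: mmin; apply/asboolP.
Qed.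

Lemma natmaxP (A : set nat) (M : nat) :
  A !=set0 -> (forall k, A k -> (k <= M)%N) ->
  A (natmax A) /\ forall k, A k -> (k <= natmax A)%N.
Proof.
move=> [k Ak] AM.
apply: (@xgetPex _ 0%N [set m | A m /\ forall k, A k -> (k <= m)%N]).
have exA : exists m, `[< A m >] by exists k; apply/asboolP.
have leA m : `[< A m >] -> (m <= M)%N by move/asboolP; apply: AM.
case: (ex_maxnP exA leA) => m /asboolP Am mmax.
by exists m; split=> // j Aj; apply: mmax; apply/asboolP.
Qed.

Section WellDefined.
Variables (G : groupType) (X : set G).
Hypotheses (finX : finite_set X) (genX : generates X).

Lemma word_exists (g : G) : exists2 w, is_word X w & \prod_(x <- w) x = g.
Proof.
have : smallest (@is_subgroup G) X g by rewrite genX.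
move/(_ [set g | exists2 w, is_word X w & \prod_(x <- w) x = g]); apply.
split; first split.
    by exists [::]; rewrite ?big_nil.
  move=> x y [u Xu <-] [v Xv <-].
  exists (u ++ [seq x^-1 | x <- rev v]) => [z|].
    rewrite mem_cat => /orP[/Xu //|/mapP[t]].
    by rewrite mem_rev => /Xv Xt ->; rewrite invgK or_comm.
  rewrite big_cat /=; congr (_ * _).
  elim: v {Xv} => [|t v IH]; first by rewrite !big_nil invg1.
  by rewrite rev_cons map_rcons big_rcons big_cons IH invgM.
by move=> x Xx; exists [:: x]; rewrite ?big_seq1 // => y; rewrite inE => /eqP->; left.
Qed.

Lemma word_length_min (g : G) :
  let A := [set size w | w in [set w | is_word X w /\ \prod_(x <- w) x = g]] in
  A (word_length X g) /\ forall k, A k -> (word_length X g <= k)%N.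
Proof.
by apply: natminP; have [w Xw wg] := word_exists g; exists (size w), w.
Qed.

Lemma conj_length_min (a b : G) : conjugate a b ->
  let A := [set word_length X g | g in [set g | a ^ g = b]] in
  A (conj_length X a b) /\ forall k, A k -> (conj_length X a b <= k)%N.
Proof. by move=> [g abg]; apply: natminP; exists (word_length X g), g. Qed.

Lemma finite_ball (n : nat) : finite_set [set g : G | (word_length X g <= n)%N].
Proof.
have finY : finite_set [set x | X x \/ X x^-1].
  suff -> : [set x | X x \/ X x^-1] = X `|` [set x^-1 | x in X].
    by rewrite finite_setU; split=> //; apply: finite_image.
  apply/seteqP; split=> x /=.
    by move=> [Xx|Xx]; [left|right=> /=; exists x^-1; rewrite ?invgK].
  by move=> [Xx|[y Xy <-]]; [left|right; rewrite invgK].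
have finW k : finite_set [set g : G | exists w,
    [/\ is_word X w, size w = k & \prod_(x <- w) x = g]].
  elim: k => [|k IH].
    apply: (sub_finite_set _ (finite_set1 1)) => g /= [w [_ /size0nil-> <-]].
    by rewrite big_nil.
  pose S := [set x | X x \/ X x^-1] `*` [set g : G | exists w,
    [/\ is_word X w, size w = k & \prod_(x <- w) x = g]].
  apply: (sub_finite_set _ (finite_image (fun p : G * G => p.1 * p.2)
    (finite_setX finY IH : finite_set S))) => g /= [[|x w]] [Xw //= [sw] <-].
  exists (x, \prod_(x <- w) x); last by rewrite big_cons.
  split=> /=; first by apply: Xw; rewrite mem_head.
  by exists w; split=> // y yw; apply: Xw; rewrite inE yw orbT.
apply: (sub_finite_set _ (@bigcup_finite _ _ `I_n.+1 _ (finite_II _)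
  (fun k _ => finW k))) => g /= gn.
have [[w [Xw wg] sw] _] := word_length_min g.
by exists (word_length X g) => //; exists w.
Qed.

Lemma CL_max (n : nat) :
  let A := [set conj_length X p.1 p.2 | p in
    [set p : G * G | conjugate p.1 p.2 /\
                     (word_length X p.1 + word_length X p.2 <= n)%N]] in
  A (CL X n) /\ forall k, A k -> (k <= CL X n)%N.
Proof.
move=> A; have finA : finite_set A.
  apply: finite_image.
  apply: (sub_finite_set _ (finite_setX (finite_ball n) (finite_ball n))).
  move=> [a b] /= [_ abn]; split=> /=; apply: leq_trans abn.
    exact: leq_addr.
  exact: leq_addl.
have /finite_seqP[s sA] := finA.
apply: (@natmaxP A (\max_(k <- s) k)).
  have l1 : word_length X 1 = 0%N.
    apply/eqP; rewrite -leqn0; apply: (word_length_min 1).2.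
    by exists [::]; rewrite //= big_nil.
  exists (conj_length X 1 1), (1, 1) => //=; rewrite l1; split=> //.
  by exists 1; rewrite conjg1.
by move=> k; rewrite sA /= => ks; apply: (@leq_bigmax_seq _ s xpredT id).
Qed.

End WellDefined.

(* Main.v *)
(** A generator with a finite conjugacy class has a centralizer of finite index,
    and the center is the intersection of the centralizers of the finitely many
    generators; so if all generators have finite conjugacy classes, then G/Z(G)
    is finite. This applies when CL is bounded by M, as every class is then the
    image of the ball of radius M.
    Otherwise some generator x has an infinite conjugacy class. Cutting a
    shortest conjugator of length at least r from x to one of its conjugates
    after r letters yields an element u of length at most r such that x and x^u
    have no conjugator shorter than r, while |x| + |x^u| <= 2r + 2 <= 4r. *)
Require Import Defs.
From mathcomp Require Import all_boot all_order.
From mathcomp Require Import mathcomp_extra boolp classical_sets functions.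
From mathcomp Require Import cardinality.

Section ConjugatorLength.
Set Implicit Arguments.
Unset Strict Implicit.
Unset Printing Implicit Defensive.
Local Open Scope classical_set_scope.
Local Open Scope group_scope.

Variables (G : groupType) (X : set G).
Hypotheses (finX : finite_set X) (genX : generates X).
Implicit Types (a b g h x z : G) (w : seq G).

Lemma word_length_le w : is_word X w ->
  (word_length X (\prod_(x <- w) x) <= size w)%N.
Proof.
by move=> Xw; apply: (word_length_min genX _).2; exists w.
Qed.

Lemma word_length_word g :
  exists w, [/\ is_word X w, \prod_(x <- w) x = g & size w = word_length X g].
Proof. by have [[w [Xw wg] sw] _] := word_length_min genX g; exists w. Qed.

Lemma word_length_gen x : X x -> (word_length X x <= 1)%N.
Proof.
move=> Xx; have : is_word X [:: x] by move=> y; rewrite inE => /eqP->; left.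
by move/word_length_le; rewrite big_cons big_nil mulg1.
Qed.

Lemma word_lengthM g h :
  (word_length X (g * h) <= word_length X g + word_length X h)%N.
Proof.
have [u [Xu <- <-]] := word_length_word g.
have [v [Xv <- <-]] := word_length_word h.
rewrite -big_cat -size_cat; apply: word_length_le => x.
by rewrite mem_cat => /orP[/Xu|/Xv].
Qed.

Lemma word_lengthV g : (word_length X g^-1 <= word_length X g)%N.
Proof.
have [w [Xw <- <-]] := word_length_word g.
have -> : (\prod_(x <- w) x)^-1 = \prod_(x <- [seq x^-1 | x <- rev w]) x.
  elim: w {Xw} => [|t w IH]; first by rewrite !big_nil invg1.
  by rewrite rev_cons map_rcons big_rcons big_cons invgM IH.
rewrite -(size_rev w) -(size_map (fun x : G => x^-1)); apply: word_length_le => x.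
by case/mapP=> y; rewrite mem_rev => /Xw Xy ->; rewrite invgK or_comm.
Qed.

Lemma word_length_conjg a g :
  (word_length X (a ^ g) <= word_length X a + (word_length X g).*2)%N.
Proof.
rewrite conjgE; apply: leq_trans (word_lengthM _ _) _.
rewrite -addnn addnCA leq_add ?word_lengthV //; exact: word_lengthM.
Qed.

Lemma conj_length_le a g : (conj_length X a (a ^ g) <= word_length X g)%N.
Proof.
by apply: (@conj_length_min _ X a (a ^ g) _).2; exists g.
Qed.

Lemma conj_length_witness a g :
  exists2 h, a ^ h = a ^ g & word_length X h = conj_length X a (a ^ g).
Proof.
have ab : conjugate a (a ^ g) by exists g.
by have [[h ahg hl] _] := conj_length_min X ab; exists h.
Qed.

Lemma conj_length_CL a g n :
  (word_length X a + word_length X (a ^ g) <= n)%N ->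
  (conj_length X a (a ^ g) <= CL X n)%N.
Proof.
move=> len; apply: (CL_max finX genX n).2.
by exists (a, a ^ g) => //; split=> //; exists g.
Qed.

Definition conj_class a : set G := range (fun g => a ^ g).

Lemma conj_class_finite a M :
  (forall g, (conj_length X a (a ^ g) <= M)%N) -> finite_set (conj_class a).
Proof.
move=> leM; apply: (sub_finite_set _ (finite_image (conjg a)
  (finite_ball finX genX M))) => _ [g _ <-].
by have [h ahg hl] := conj_length_witness a g; exists h; rewrite //= hl.
Qed.

Lemma conjg_eq_commute x g h : x ^ g = x ^ h -> commute (g * h^-1) x.
Proof.
move=> xgh; apply/commute_sym/commgP/conjg_fixP.
by rewrite conjgM xgh conjgK.
Qed.

(** The centralizer of [z] is a subgroup, so it is all of [G] once it contains [X]. *)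
Lemma center_gen z : (forall x, X x -> commute z x) -> center G z.
Proof.
move=> zX g.
have : smallest (@is_subgroup G) X g by rewrite genX.
move/(_ [set g | commute z g]); apply; split=> //; split=> [|x y zx zy].
  exact: commute1.
exact/commuteM/commuteV.
Qed.

(** The tuples lie in a finite product of conjugacy classes. This stands in for the finite index of
    the intersection of the centralizers, whose cosets are the fibers of the map. *)
Lemma finite_conj_tuples (s : seq G) :
  (forall x, x \in s -> finite_set (conj_class x)) ->
  finite_set (range (fun g => [seq x ^ g | x <- s])).
Proof.
elim: s => [|x s IH] fins.
  by apply: (sub_finite_set _ (finite_set1 [::])) => _ [g _ <-].
have finx := fins x (mem_head x s).
have {}/IH finxs y : y \in s -> finite_set (conj_class y).
  by move=> ys; apply: fins; rewrite inE ys orbT.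
apply: (sub_finite_set _ (finite_image (fun p => p.1 :: p.2)
  (finite_setX finx finxs))) => _ [g _ <-].
by exists (x ^ g, [seq y ^ g | y <- s]) => //; split; exists g.
Qed.

(* The coset of g modulo the center is the fiber through g of the map sending h
   to the tuple of the conjugates by h of all the generators. *)
Lemma center_cosets_finite :
  (forall x, X x -> finite_set (conj_class x)) -> finite_set (center_cosets G).
Proof.
have /finite_seqP[s Xs] := finX => finC.
pose phi g := [seq x ^ g | x <- s].
have finphi : finite_set (range phi).
  by apply: finite_conj_tuples => x xs; apply: finC; rewrite Xs.
apply: (sub_finite_set _ (finite_image (fun t => [set h | phi h = t]) finphi)).
move=> _ [g _ <-]; exists (phi g); first by exists g.
apply/seteqP; split=> h /=.
  (* Equal tuples put [h * g^-1] on the left of [g]; being central, it can be moved to the right. *)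
  move/eq_in_map=> hg; have Zhg : center G (h * g^-1).
    by apply: center_gen => x; rewrite Xs => /hg/conjg_eq_commute.
  by exists (h * g^-1) => //; rewrite -(Zhg g) mulgVK.
case=> z Zz <-; apply: eq_map => x.
by rewrite conjgM [LHS](conjg_fixP _) //; apply/commgP/commute_sym/Zz.
Qed.

Lemma bounded_CL_conj_class a : bounded (CL X) -> finite_set (conj_class a).
Proof.
move=> [M leM]; apply: (@conj_class_finite a M) => g.
(* The successor makes the argument positive, as [bounded] requires. *)
apply: leq_trans (leM (word_length X a + word_length X (a ^ g)).+1 isT).
exact: conj_length_CL.
Qed.

(** Conjugation by [g] depends only on the coset of [g] modulo the center, so the lengths of
    finitely many representatives bound [CL X]. *)
Lemma center_cosets_bounded_CL :
  finite_set (center_cosets G) -> bounded (CL X).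
Proof.
(* [xget 1] chooses the representatives; its default is never reached, since cosets are nonempty. *)
move=> /(finite_image (fun C => word_length X (xget 1 C)))/finite_seqP[s sE].
exists (\max_(k <- s) k) => n _.
have [[[a _] /= [[g <-] _] <-] _] := CL_max finX genX n.
pose C := [set g * z | z in center G].
have [z Zz gz] : C (xget 1 C).
  apply: (@xgetPex _ 1 C).
  by exists (g * 1), 1 => // h; apply/commute_sym/commute1.
have -> : a ^ g = a ^ xget 1 C.
  by rewrite -gz conjgM [RHS](conjg_fixP _) //; apply/commgP/commute_sym/Zz.
apply: leq_trans (conj_length_le _ _) _.
apply: (@leq_bigmax_seq _ s xpredT id) => //.
suff : [set` s] (word_length X (xget 1 C)) by [].
by rewrite -sE; exists C => //; exists g.
Qed.

Lemma conj_length_prefix a g r : (r <= conj_length X a (a ^ g))%N ->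
  exists2 u, (word_length X u <= r)%N & (r <= conj_length X a (a ^ u))%N.
Proof.
have [h ah lh] := conj_length_witness a g.
have [w [Xw wh sw]] := word_length_word h => rle.
have Xtake : is_word X (take r w) by move=> x /mem_take/Xw.
have Xdrop : is_word X (drop r w) by move=> x /mem_drop/Xw.
set u := \prod_(x <- take r w) x; set v := \prod_(x <- drop r w) x.
have lu : (word_length X u <= r)%N.
  by apply: leq_trans (word_length_le Xtake) _; rewrite size_take_min geq_minl.
exists u => //.
have lv := word_length_le Xdrop; rewrite -/v size_drop sw lh in lv.
have [k ak <-] := conj_length_witness a u.
have akv : a ^ (k * v) = a ^ g.
  by rewrite conjgM ak -conjgM -big_cat cat_take_drop wh.
(* With L the length of [h], minimality gives L <= |k| + |v| <= |k| + (L - r), hence r <= |k|. *)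
have := leq_trans (conj_length_le a (k * v)) (word_lengthM k v).
rewrite akv => /leq_trans/(_ (leq_add (leqnn _) lv)).
by rewrite addnBA // leq_subRL ?leq_add2r // (leq_trans rle) // leq_addl.
Qed.

Lemma conj_class_infinite_linear x :
  X x -> ~ finite_set (conj_class x) -> at_least_linear (CL X).
Proof.
move=> Xx infx; exists 1%N, 4%N; split=> // r r_gt0; rewrite mul1n.
have [g rg] : exists g, (r <= conj_length X x (x ^ g))%N.
  apply: contrapT => far; apply: infx; apply: (@conj_class_finite x r) => g.
  by rewrite leqNgt; apply/negP => /ltnW rg; apply: far; exists g.
have [u ur ru] := conj_length_prefix rg.
apply: leq_trans ru _; apply: conj_length_CL.
have lx := word_length_gen Xx.
apply: leq_trans (leq_add lx (word_length_conjg x u)) _.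
rewrite addnA -[4%N]/(2 + 2)%N mulnDl mul2n leq_add ?leq_double //.
apply: (@leq_trans 2); last by rewrite -(leq_double 1) in r_gt0.
by rewrite ltnS.
Qed.

End ConjugatorLength.

Theorem proposition6p1 (G : groupType) (X : set G)
    (finX : finite_set X) (genX : generates X) :
  (bounded (CL X) <-> finite_set (center_cosets G)) /\
  (~ bounded (CL X) -> at_least_linear (CL X)).
Proof.
have bdd := center_cosets_bounded_CL finX genX.
split; [split=> // /bounded_CL_conj_class fin|].
  by apply: (center_cosets_finite finX genX) => x _; apply: fin.
(* If growth is not at least linear, all generators have finite classes, which makes [CL X]
   bounded. *)
move=> nbdd; apply: contrapT => nlin; apply/nbdd/bdd.
apply: (center_cosets_finite finX genX) => x Xx; apply: contrapT => infx.
exact/nlin/(conj_class_infinite_linear finX genX Xx).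
Qed.
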